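(* Let $\mathbb{F}$ be an algebraically closed field and let $n,t\in\mathbb{Z}^+$ with $n=2t$. Let $\mathcal{S}$ be a generating system of the full matrix algebra $\mathrm{M}_n(\mathbb{F})$. If $m(\mathcal{S})=t+k$ for some $k\in\{1,2,\ldots,t\}$, then $\ell(\mathcal{S})\le 3n-5$.
   Context: $\mathrm{M}_n(\mathbb{F})$ is the algebra of $n\times n$ matrices over $\mathbb{F}$. Let $\mathcal{S}$ be a finite subset of $\mathrm{M}_n(\mathbb{F})$. A word of length $j$ in $\mathcal{S}$ is a product of $j$ elements of $\mathcal{S}$ (repetitions allowed); the identity matrix is regarded as the (empty) word of length $0$. For $i\ge 0$, $L_i(\mathcal{S})$ denotes the $\mathbb{F}$-linear span of all words in $\mathcal{S}$ of length at most $i$, so $L_0(\mathcal{S})$ is the set of scalar matrices. $L(\mathcal{S})=\bigcup_{i\ge 0}L_i(\mathcal{S})$. $\mathcal{S}$ is a generating system of $\mathrm{M}_n(\mathbb{F})$ if $L(\mathcal{S})=\mathrm{M}_n(\mathbb{F})$. The length $\ell(\mathcal{S})$ of a generating system $\mathcal{S}$ is the minimum non-negative integer $i$ such that $L_i(\mathcal{S})=\mathrm{M}_n(\mathbb{F})$. For a matrix $w$, $\deg w$ denotes the degree of the minimal polynomial of $w$ over $\mathbb{F}$, and $m(\mathcal{S})=\max\{\deg w : w\in\mathcal{S}\}$.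
   Formalization: The case t = 1 (n = 2) is excluded, because the claim fails there: S = {E12, E21} generates the 2×2 matrices with m(S) = 2 = t + 1 but has length 2 > 1 = 3n − 5; the theorem is stated for t ≥ 2. *)

(* Defs.v *)
From HB Require Import structures.
From mathcomp Require Import all_boot all_order all_algebra.
From mathcomp Require Import finmap.

Set Implicit Arguments.
Unset Strict Implicit.
Unset Printing Implicit Defensive.

Import GRing.Theory.
Local Open Scope ring_scope.

(* The matrix size is n.+1 because degree_mxminpoly is only available there. *)
Section Length.

Variables (F : fieldType) (n : nat).
Implicit Type S : {fset 'M[F]_n.+1}.

Fixpoint words S (j : nat) : seq 'M[F]_n.+1 :=
  if j is j'.+1 then [seq a * w | a <- enum_fset S, w <- words S j']
  else [:: 1].

Definition words_upto S (i : nat) : seq 'M[F]_n.+1 :=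
  flatten [seq words S j | j <- iota 0 i.+1].

Definition word_span S (i : nat) : {vspace 'M[F]_n.+1} := <<words_upto S i>>%VS.

Definition generating S : Prop := forall A : 'M[F]_n.+1, exists i, A \in word_span S i.

Lemma words_uptoP S i (w : 'M[F]_n.+1) :
  reflect (exists2 j, (j <= i)%N & w \in words S j) (w \in words_upto S i).
Proof.
by apply: (iffP flatten_mapP) => -[j ji wj]; exists j; rewrite // mem_iota in ji *.
Qed.

Lemma word_spanS S i j : (i <= j)%N -> (word_span S i <= word_span S j)%VS.
Proof.
move=> le_ij; apply: sub_span => w /words_uptoP[l li wl].
by apply/words_uptoP; exists l => //; apply: leq_trans le_ij.
Qed.

Lemma generating_word_span S : generating S -> exists i, word_span S i == fullv.
Proof.
move=> genS.
have seq_span (s : seq 'M[F]_n.+1) : exists i, forall A, A \in s -> A \in word_span S i.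
  elim: s => [|A s [i IHs]]; first by exists 0%N.
  have [j Aj] := genS A; exists (maxn i j) => B; rewrite inE => /predU1P[->|/IHs].
    exact: subvP (word_spanS S (leq_maxr i j)) _ Aj.
  exact: subvP (word_spanS S (leq_maxl i j)) _.
have [i iP] := seq_span (vbasis {:'M[F]_n.+1}).
by exists i; rewrite eqEsubv subvf -(span_basis (vbasisP fullv)); apply/span_subvP.
Qed.

Definition gen_length S (genS : generating S) : nat :=
  ex_minn (generating_word_span genS).

Definition max_degree S : nat :=
  (\max_(w <- enum_fset S) degree_mxminpoly w)%N.

End Length.

(* Main.v *)
(* Write N for the matrix size, A in S for a matrix of degree m > N/2 and p for
   its minimal polynomial. If every (p / (X - l))(A), for l a root of p, had rank
   at least 2, then removing the roots of p one at a time would drop the rank by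
   at least 2 each time, whence N >= 2m; so one of them is of the form x y, and
   it lies in L_{N-1}. Suppose that C <> 0 and tr(B C) = 0 for all B in L_{3N-5}.
   Then y L_{N-1} C L_{N-3} x = 0. Since L_{N-1} v is the whole space for v <> 0,
   C kills L_{N-3} x, which has dimension at least N - 2, so C has rank at most 2.
   Then M_N C has dimension at most 2N, so it is equal to L_{2N-1} C, on which
   the trace vanishes as 2N - 1 <= 3N - 5. Hence C = 0. *)
Require Import Defs.
From mathcomp Require Import all_boot all_order all_algebra.
From mathcomp Require Import finmap.
From mathcomp Require Import zify.

(** * A polynomial of rank one in a matrix of large degree *)

Section RankOne.

Import GRing.Theory.
Local Open Scope ring_scope.

Lemma mxrank_horner_prod_XsubC {F : fieldType} {n : nat} (A : 'M[F]_n.+1)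
    (p u : {poly F}) (s : seq F) (r : nat) :
    horner_mx A p = 0 -> u * \prod_(l <- s) ('X - l%:P) = p ->
    (forall l q, q * ('X - l%:P) = p -> (r <= \rank (horner_mx A q))%N) ->
  (r * size s <= \rank (horner_mx A u))%N.
Proof.
(* If [l] is among the roots of [p / u], then [(p / (X - l))(A)] factors through
   [u(A)] and is killed by [A - l], so it accounts for the drop in rank from
   [u(A)] to [(u (X - l))(A)]. *)
move=> pA0 + r_le; elim: s u => [|l s IHs] u; first by rewrite muln0.
rewrite big_cons => def_p.
have Xq : u * \prod_(j <- s) ('X - j%:P) * ('X - l%:P) = p by rewrite -def_p mulrAC mulrA.
have /IHs le1 : u * ('X - l%:P) * \prod_(j <- s) ('X - j%:P) = p by rewrite -mulrA.
rewrite -(mxrank_mul_ker _ (horner_mx A ('X - l%:P))) mulnS addnC leq_add //.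
  by apply: leq_trans le1 _; rewrite rmorphM.
apply: leq_trans (r_le _ _ Xq) (mxrankS _).
rewrite sub_capmx; apply/andP; split; first by rewrite mulrC rmorphM submxMl.
by apply/sub_kermxP; rewrite -[LHS]/(_ * _) -rmorphM Xq.
Qed.

Lemma horner_mx_rank1 {F : closedFieldType} {n : nat} (A : 'M[F]_n.+1) :
    (n.+1 < 2 * degree_mxminpoly A)%N ->
  exists2 q : {poly F}, (size q <= degree_mxminpoly A)%N & \rank (horner_mx A q) = 1%N.
Proof.
set p := mxminpoly A => lt_n.
have [s] := closed_field_poly_normal p.
rewrite (monicP (mxminpoly_monic A)) scale1r => def_p.
have p_neq0 : p != 0 by rewrite monic_neq0 ?mxminpoly_monic.
have sz_s : size s = degree_mxminpoly A.
  by apply: succn_inj; rewrite -size_mxminpoly -/p def_p size_prod_XsubC.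
have sz_q l q : q * ('X - l%:P) = p -> size q = degree_mxminpoly A.
  move=> def_q; apply: succn_inj; rewrite -size_mxminpoly -/p -def_q.
  rewrite size_Mmonic ?monicXsubC ?size_XsubC ?addn2 //.
  by apply: contraNneq p_neq0 => q0; rewrite -def_q q0 mul0r.
have [/hasP[l ls /eqP rk1] | /hasPn no_rk1] :=
  boolP (has (fun l => \rank (horner_mx A (p %/ ('X - l%:P))) == 1%N) s).
  exists (p %/ ('X - l%:P)) => //; rewrite (sz_q l) // divpK // dvdp_XsubCl.
  by rewrite def_p root_prod_XsubC.
have r_le l q : q * ('X - l%:P) = p -> (2 <= \rank (horner_mx A q))%N.
  move=> def_q; have ls : l \in s.
    by rewrite -root_prod_XsubC -def_p -def_q rootM root_XsubC eqxx orbT.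
  have := no_rk1 l ls; rewrite -def_q mulpK ?polyXsubC_eq0 // => rk1.
  (* [q] is nonzero of smaller degree than the minimal polynomial, so it does not annihilate [A]. *)
  have rk0 : \rank (horner_mx A q) != 0%N.
    rewrite mxrank_eq0 -dvd_mxminpoly; apply/negP => /dvdp_leq.
    have q_neq0 : q != 0 by apply: contraNneq p_neq0 => q0; rewrite -def_q q0 mul0r.
    by move/(_ q_neq0); rewrite size_mxminpoly (sz_q l q def_q) ltnn.
  by move: rk0 rk1; case: (\rank _) => [|[]].
(* From [u = 1], whose value at [A] is the identity, each root costs rank 2, so twice the degree is
   at most [n.+1]: a contradiction. *)
have := @mxrank_horner_prod_XsubC _ _ A p 1 s 2 (mx_root_minpoly A).
rewrite mul1r -def_p => /(_ erefl r_le) le_rk.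
have := leq_trans le_rk (rank_leq_row _).
by rewrite sz_s leqNgt lt_n.
Qed.

End RankOne.

(** * Spans of words and their products with a fixed matrix *)

Section WordSpan.

Import GRing.Theory.
Local Open Scope ring_scope.

Context {F : fieldType} {n : nat}.
Implicit Types (S : {fset 'M[F]_n.+1}) (A B C : 'M[F]_n.+1).

Lemma words_span S i j w : (j <= i)%N -> w \in words S j -> w \in word_span S i.
Proof. by move=> ji wj; apply/memv_span/words_uptoP; exists j. Qed.

Lemma word_span1 S i : 1 \in word_span S i.
Proof. by rewrite (@words_span S i 0) ?inE. Qed.

Lemma word_span_linear {vT : vectType F} (f : {linear 'M[F]_n.+1 -> vT})
    (W : {vspace vT}) S i B :
    (forall j w, (j <= i)%N -> w \in words S j -> f w \in W) ->
  B \in word_span S i -> f B \in W.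
Proof.
move=> fW Bi; rewrite -[f B](lfunE f); apply: subvP (memv_img (linfun f) Bi).
rewrite limg_span; apply/span_subvP => _ /mapP[w /words_uptoP[j ji wj] ->].
by rewrite lfunE; apply: fW ji wj.
Qed.

Lemma word_span_mull S i A B : A \in S -> B \in word_span S i -> A * B \in word_span S i.+1.
Proof.
move=> AS; apply: (word_span_linear (mulmx A)) => j w ji wj.
by apply: (@words_span S i.+1 j.+1) => //; apply: allpairs_f.
Qed.

Lemma word_spanM S i j A B :
  A \in word_span S i -> B \in word_span S j -> A * B \in word_span S (i + j).
Proof.
move=> + Bj; apply: (word_span_linear (mulmxr B)) => l w li wl.
apply: (subvP (word_spanS S (leq_add li (leqnn j)))).
elim: l w wl {li} => [|l IHl] w /=; first by rewrite inE => /eqP->; rewrite mul1mx.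
case/allpairsP=> -[a b] [/= aS bl ->]; rewrite -mulmxA.
by apply: word_span_mull => //; apply: IHl.
Qed.

Lemma word_spanX S i A : A \in S -> A ^+ i \in word_span S i.
Proof.
move=> AS; elim: i => [|i IHi]; first exact: word_span1.
by rewrite exprS word_span_mull.
Qed.

Lemma word_span_horner S i A (q : {poly F}) :
  A \in S -> (size q <= i.+1)%N -> horner_mx A q \in word_span S i.
Proof.
move=> AS sz_q; rewrite -[q]coefK poly_def rmorph_sum rpred_sum //= => k _.
rewrite linearZ rpredZ //= rmorphXn /= horner_mx_X.
apply: (subvP (word_spanS S _)) (word_spanX S k A AS).
by rewrite -ltnS (leq_trans (ltn_ord k)).
Qed.

(** The width [r] is free so as to cover both single vectors and a column basis of a matrix. *)
Definition mulmxr_span S {r} (G : 'M[F]_(n.+1, r)) (i : nat) : {vspace 'M[F]_(n.+1, r)} :=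
  (linfun (mulmxr G) @: word_span S i)%VS.

Lemma mem_mulmxr_span S r (G : 'M[F]_(n.+1, r)) i X :
  reflect (exists2 B, B \in word_span S i & X = B *m G) (X \in mulmxr_span S G i).
Proof. by apply: (iffP memv_imgP) => -[B Bi ->]; exists B; rewrite // lfunE. Qed.

Lemma mulmxr_spanS S r (G : 'M[F]_(n.+1, r)) i j :
  (i <= j)%N -> (mulmxr_span S G i <= mulmxr_span S G j)%VS.
Proof. by move=> ij; apply/limgS/word_spanS. Qed.

(** Induction on the length of words: a further letter on the left moves the span for [i] into that
    for [i.+1], hence back into itself. *)
Lemma mulmxr_span_stable S r (G : 'M[F]_(n.+1, r)) i j :
  (mulmxr_span S G i.+1 <= mulmxr_span S G i)%VS ->
  (mulmxr_span S G j <= mulmxr_span S G i)%VS.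
Proof.
move=> stab.
have wG l w : w \in words S l -> w *m G \in mulmxr_span S G i.
  elim: l w => [|l IHl] w /=.
    by rewrite inE => /eqP->; apply/mem_mulmxr_span; exists 1; rewrite ?mul1mx ?word_span1 //.
  case/allpairsP=> -[a b] [/= aS bl ->].
  have /mem_mulmxr_span[B Bi eB] := IHl b bl.
  apply: (subvP stab); apply/mem_mulmxr_span; exists (a * B); first exact: word_span_mull.
  by rewrite -[a * b]/(a *m b) -mulmxA eB mulmxA.
apply/subvP => _ /mem_mulmxr_span[B + ->].
by apply: (word_span_linear (mulmxr G)) => l w _; apply: wG.
Qed.

(* The chain of spans increases strictly until it is stationary, and it can only
   be stationary at the whole space since [S] generates. *)
Lemma dim_mulmxr_span S r (G : 'M[F]_(n.+1, r)) i :
  generating S -> (0 < r)%N -> row_full G ->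
  (minn i.+1 (n.+1 * r) <= \dim (mulmxr_span S G i))%N.
Proof.
move=> genS r_gt0 G_full; elim: i => [|i IHi].
  rewrite (leq_trans (geq_minl _ _)) // lt0n dimv_eq0; apply/eqP => G0.
  have : G \in mulmxr_span S G 0.
    by apply/mem_mulmxr_span; exists 1; rewrite ?mul1mx ?word_span1 //.
  rewrite G0 memv0 => /eqP G_eq0; move: G_full; rewrite G_eq0 /row_full mxrank0.
  by rewrite eq_sym (gtn_eqF r_gt0).
have [le_dim|gt_dim] := leqP (\dim (mulmxr_span S G i.+1)) (\dim (mulmxr_span S G i)).
  have stab : (mulmxr_span S G i.+1 <= mulmxr_span S G i)%VS.
    by rewrite -(dimv_leqif_sup (mulmxr_spanS S r G i i.+1 (leqnSn i))) eqn_leq le_dim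
      (dimvS (mulmxr_spanS S r G i i.+1 (leqnSn i))).
  have -> : mulmxr_span S G i.+1 = fullv.
    apply/eqP; rewrite eqEsubv subvf /=; apply/subvP => X _.
    (* [pinvmx G] is a left inverse of [G], so a word span containing [X *m pinvmx G] reaches
       [X]. *)
    have [j Bj] := genS (X *m pinvmx G).
    apply: (subvP (mulmxr_spanS S r G i i.+1 (leqnSn i))).
    apply: (subvP (mulmxr_span_stable S r G i j stab)); apply/mem_mulmxr_span.
    by exists (X *m pinvmx G); rewrite // -mulmxA mulVpmx ?mulmx1.
  by rewrite dimvf dim_matrix geq_minr.
by apply: leq_trans gt_dim; move: IHi; rewrite !geq_min; lia.
Qed.

Lemma mulmxr_span_full S r (G : 'M[F]_(n.+1, r)) i :
  generating S -> (0 < r)%N -> row_full G -> (n.+1 * r <= i.+1)%N ->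
  mulmxr_span S G i = fullv.
Proof.
move=> genS r_gt0 G_full le_i; apply/eqP; rewrite eqEdim subvf dimvf dim_matrix.
by have := dim_mulmxr_span S r G i genS r_gt0 G_full; rewrite (minn_idPr le_i).
Qed.

End WordSpan.

(** * Trace duality and annihilated subspaces *)

Section TraceDuality.

Import GRing.Theory.
Local Open Scope ring_scope.

Lemma trace_orthogonal {F : fieldType} {n : nat} (W : {vspace 'M[F]_n.+1}) :
  W != fullv -> exists2 C, C != 0 & forall B, B \in W -> \tr (B *m C) = 0.
Proof.
rewrite eqEsubv subvf /= => /subvPn[v _ vW].
pose f := (\1 - projv W)%VF.
have fE B : f B = B - projv W B by rewrite add_lfunE opp_lfunE id_lfunE.
have f0 B : B \in W -> f B = 0 by move=> BW; rewrite fE projv_id ?subrr.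
have /matrix0Pn[i [j fv]] : f v != 0.
  by rewrite fE subr_eq0; apply: contraNneq vW => ->; apply: memv_proj.
(* The indices are swapped so that the trace of [B *m C] is the entry [i j] of [f B], a functional
   that vanishes on [W] but not at [v]. *)
pose C := \matrix_(k, l) f (delta_mx l k) i j.
have trC B : \tr (B *m C) = f B i j.
  rewrite {2}[B]matrix_sum_delta linear_sum summxE /mxtrace; apply: eq_bigr => k _.
  rewrite linear_sum summxE mxE; apply: eq_bigr => l _.
  by rewrite linearZ !mxE.
exists C => [|B BW]; last by rewrite trC f0 ?mxE.
by apply: contraNneq fv => C0; rewrite -trC C0 mulmx0 mxtrace0.
Qed.

(** [U] lies in the kernel of [C]. As [kermx] consists of rows, [f] parametrises this kernel by
    transposing. *)
Lemma mxrank_annihilated {F : fieldType} {m n : nat} (C : 'M[F]_(m, n))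
    (U : {vspace 'cV[F]_n}) :
  (forall v, v \in U -> C *m v = 0) -> (\rank C + \dim U <= n)%N.
Proof.
move=> CU; pose K := row_base (kermx C^T).
pose f := linfun (trmx \o mulmxr K : 'rV[F]_(\rank (kermx C^T)) -> 'cV[F]_n).
have /dimvS le_U : (U <= limg f)%VS.
  apply/subvP => v /CU Cv; apply/memv_imgP.
  have /submxP[z vK] : (v^T <= K)%MS.
    by rewrite eq_row_base sub_kermx -trmx_mul Cv trmx0 eqxx.
  by exists z; rewrite ?memvf // lfunE /= -vK trmxK.
have := leq_trans le_U (leq_trans (leq_addl _ _) (eq_leq (limg_ker_dim f _))).
rewrite dimvf dim_matrix [(_ * _)%R]mul1n mxrank_ker mxrank_tr => le_dim.
by have := rank_leq_col C; lia.
Qed.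

End TraceDuality.

(** * The length bound from a matrix of rank one *)

Section RankOneLength.

Import GRing.Theory.
Local Open Scope ring_scope.

(* The matrix size is N = n + 1, so that 3 * n - 2 = 3N - 5. *)
Lemma word_span_rank1_full {F : fieldType} {n : nat} (S : {fset 'M[F]_n.+1})
    (P : 'M[F]_n.+1) :
    (2 < n)%N -> generating S -> P \in word_span S n -> \rank P = 1%N ->
  word_span S (3 * n - 2) = fullv.
Proof.
move=> n_gt2 genS Pn rkP; apply/eqP/negPn/negP => /trace_orthogonal[C C_neq0 trC].
have [x [y [x_neq0 y_neq0 defP]]] :
    exists x : 'cV[F]_n.+1, exists y : 'rV[F]_n.+1, [/\ x != 0, y != 0 & P = x *m y].
  have P_neq0 : P != 0 by rewrite -mxrank_eq0 rkP.
  move: (col_base P) (row_base P) (mulmx_base P); rewrite rkP => x y xy.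
  exists x, y; split=> //; apply: contraNneq P_neq0 => z0;
    by rewrite -xy z0 ?mul0mx ?mulmx0.
have cV_full (v : 'cV[F]_n.+1) : v != 0 -> row_full v.
  by rewrite /row_full eqn_leq rank_leq_col lt0n mxrank_eq0.
(* Otherwise some [B1] sends [C *m (B2 *m x)] to the [i]-th basis vector, and the [i]-th entry of
   [y] is the trace of [B2 *m P *m B1 *m C], which is 0. *)
have CB2x B2 : B2 \in word_span S (n - 2) -> C *m (B2 *m x) = 0.
  move=> B2n; apply: contraNeq y_neq0 => v_neq0.
  have full : mulmxr_span S (C *m (B2 *m x)) n = fullv.
    by rewrite mulmxr_span_full ?cV_full ?muln1.
  apply/eqP/trmx_inj; rewrite trmx0; apply/matrixP => i k; rewrite !mxE.
  have /mem_mulmxr_span[B1 B1n /(congr1 (mulmx y))] :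
    delta_mx i 0 \in mulmxr_span S (C *m (B2 *m x)) n by rewrite full memvf.
  rewrite -colE => /matrixP/(_ 0 0); rewrite mxE => yi.
  rewrite [k]ord1 yi -[RHS](trC (B2 *m P *m B1)); last first.
    have -> : (3 * n - 2 = n - 2 + n + n)%N by lia.
    exact: (word_spanM _ _ _ _ _ (word_spanM _ _ _ _ _ B2n Pn) B1n).
  have -> : B2 *m P *m B1 *m C = (B2 *m x) *m (y *m B1 *m C) by rewrite defP !mulmxA.
  by rewrite mxtrace_mulC trace_mx11 !mulmxA.
have rkC : (\rank C <= 2)%N.
  have := @mxrank_annihilated _ _ _ C (mulmxr_span S x (n - 2)).
  have := dim_mulmxr_span S 1 x (n - 2) genS isT (cV_full x x_neq0).
  rewrite muln1 => le_dim /(_ _) => le_rk.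
  have : (\rank C + \dim (mulmxr_span S x (n - 2)) <= n.+1)%N.
    by apply: le_rk => _ /mem_mulmxr_span[B2 B2n ->]; apply: CB2x.
  by move: le_dim; rewrite (minn_idPl _); lia.
have full : mulmxr_span S (col_base C) (3 * n - 2) = fullv.
  apply: mulmxr_span_full; rewrite ?col_base_full ?lt0n ?mxrank_eq0 //.
  (* [2 < n] gives 2(n + 1) <= 3n - 1. *)
  by apply: leq_trans (leq_mul (leqnn _) rkC) _; lia.
case/negP: C_neq0; rewrite -[C]mulmx_base; apply/eqP.
suffices -> : row_base C = 0 by rewrite mulmx0.
apply/matrixP => i j; rewrite [RHS]mxE.
(* For this [B], the trace of [B *m C] is the entry [i j] of [row_base C]. *)
have /mem_mulmxr_span[B Bn defB] :
  delta_mx j i \in mulmxr_span S (col_base C) (3 * n - 2) by rewrite full memvf.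
have <- : \tr (B *m (col_base C *m row_base C)) = 0 by rewrite mulmx_base trC.
rewrite mulmxA -defB /mxtrace (bigD1 j) //=.
rewrite big1 => [|k kj]; last first.
  by rewrite mxE big1 // => l _; rewrite mxE (negPf kj) mul0r.
rewrite addr0 [in RHS]mxE (bigD1 i) //= big1 => [|l li]; last by rewrite mxE (negPf li) andbF mul0r.
by rewrite [delta_mx _ _ _ _]mxE !eqxx mul1r addr0.
Qed.

End RankOneLength.

Theorem theorem1p2 (F : closedFieldType) (n t k : nat)
    (t_gt1 : 1 < t) (n_eq : n.+1 = 2 * t)
    (S : {fset 'M[F]_n.+1}) (genS : generating S)
    (k_bounds : 1 <= k <= t) (degS : max_degree S = t + k) :
  gen_length genS <= 3 * n.+1 - 5.
Proof.
have [A AS degA] : exists2 A, A \in S & t + k <= degree_mxminpoly A.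
  apply/hasP; apply: contraTT k_bounds => /hasPn degS_lt.
  suffices : max_degree S <= (t + k).-1 by rewrite degS; lia.
  by apply/bigmax_leqP_seq => w /degS_lt; lia.
have deg_le : degree_mxminpoly A <= n.+1.
  rewrite -ltnS -size_mxminpoly -(size_char_poly A) dvdp_leq ?mxminpoly_dvd_char //.
  by rewrite monic_neq0 ?char_poly_monic.
(* As [k] is positive, 2(t + k) > 2t = n + 1. *)
have [|q sz_q rk1] := horner_mx_rank1 A; first by lia.
have qAn := word_span_horner S n A q AS (leq_trans sz_q deg_le).
have -> : 3 * n.+1 - 5 = 3 * n - 2 by lia.
rewrite /gen_length; case: ex_minnP => i _; apply; apply/eqP.
by apply: word_span_rank1_full rk1; first by lia.
Qed.
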